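(* Let $T$ be a locally finite infinite tree. Let $G\le \mathrm{Aut}(T)$ be a closed, non-compact subgroup with Tits' independence property and let $(\pi,\mathcal{H})$ be a unitary representation of $G$. Assume there exist a sequence $\{g_n\}_{n>0}\subset G$ and a vector $v\in\mathcal{H}$ such that $g_n\to\infty$ and $\{\pi(g_n)(v)\}_{n>0}$ converges weakly to a non-zero vector $v_0\in\mathcal{H}$. Then, for each $\xi\in\partial T$ with the property that there exist a vertex $x\in T$ and a subsequence $\{g_{n_k}\}$ such that $g_{n_k}(x)\to\xi$, we have $$N^+_{\{g_{n_k}\}}\le G_\xi^0\le G_{v_0}.$$ Moreover, if $G_{v_0}$ is non-compact and does not contain hyperbolic elements, then $G_{v_0}=G_\eta^0$ for some end $\eta\in\partial T$.
   Context: $\mathrm{Aut}(T)$ carries the compact-open topology, $\partial T$ is the set of ends of $T$, and convergence $g_{n_k}(x)\to\xi$ is with respect to the cone topology on $T\cup\partial T$. $g_n\to\infty$ means that the sequence eventually leaves every compact subset of $G$. A unitary representation is a strongly continuous homomorphism $\pi:G\to\mathcal{U}(\mathcal{H})$ with $\mathcal{H}$ an (infinite-dimensional) complex Hilbert space. A closed subgroup $G\le\mathrm{Aut}(T)$ has Tits' independence property if for every edge $e$ of $T$ one has $G_e=G_{T_{e,1}}G_{T_{e,2}}$, where $G_e$ is the pointwise stabilizer of $e$, $T_{e,1},T_{e,2}$ are the two half sub-trees of $T$ emanating from $e$ and containing $e$ (one on each side of $e$), and $G_{T_{e,i}}$ is the pointwise stabilizer of $T_{e,i}$. For a sequence $\alpha=\{g_n\}$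 in $G$: $U^+_\alpha:=\{g\in G\mid \lim_{n\to\infty} g_n^{-1}gg_n=e\}$ (a subgroup of $G$) and $N^+_\alpha:=\overline{U^+_\alpha}$ is its closure. $G_\xi^0:=\{g\in G\mid g(\xi)=\xi \text{ and } g \text{ is elliptic}\}$, where an element fixing an end is elliptic if it fixes a vertex. $G_{v_0}:=\{g\in G\mid \pi(g)(v_0)=v_0\}$. An automorphism is hyperbolic if it translates a bi-infinite geodesic line by a positive amount. *)

(* Defs.v *)
(* MathComp and MathComp-Analysis. *)
From HB Require Import structures.
From mathcomp Require Import all_boot all_order all_algebra sesquilinear.
From mathcomp Require Import all_classical all_reals all_analysis.
From mathcomp Require Import complex.

Set Implicit Arguments.
Unset Strict Implicit.
Unset Printing Implicit Defensive.

Import Order.TTheory GRing.Theory Num.Theory.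
Import numFieldNormedType.Exports.
Local Open Scope classical_set_scope.
Local Open Scope quotient_scope.
Local Open Scope group_scope.

(* A tree is given by its vertices and its (symmetric, loopless) adjacency
   relation; the edge between a and b is represented by the ordered pairs (a, b)
   and (b, a). *)
Record tree := Tree {
  vertex :> choiceType;
  adj : rel vertex;
  adj_sym : symmetric adj;
  adj_irr : irreflexive adj;
  adj_connected : forall x y, exists2 p, path adj x p & last x p = y;
  adj_acyclic : forall c, (2 < size c)%N -> ~~ ucycleb adj c
}.

Definition locally_finite (T : tree) :=
  forall x : T, finite_set [set y | adj x y].

Definition infinite_tree (T : tree) := infinite_set [set: T].

Section Tree.
Variable T : tree.
Implicit Types x y z : T.

Lemma reachable x y :
  exists n, `[< exists p, [/\ path (@adj T) x p, last x p = y & size p = n] >].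
Proof.
by have [p xp py] := adj_connected x y; exists (size p); apply/asboolP; exists p.
Qed.

Definition dist x y : nat := ex_minn (reachable x y).

Definition segment x y : set T :=
  [set z | (dist x z + dist z y)%N = dist x y].

Definition is_ray : pred (nat -> T) := fun r =>
  `[< forall i j, (i <= j)%N -> dist (r i) (r j) = (j - i)%N >].

Record ray := Ray { ray_fun :> nat -> T; rayP : is_ray ray_fun }.
HB.instance Definition _ := [isSub for ray_fun].
HB.instance Definition _ := [Choice of ray by <:].

Definition asymptotic : rel ray := fun r s =>
  `[< exists m k : nat, forall n, r (m + n)%N = s (k + n)%N >].

Lemma asymptotic_refl : reflexive asymptotic.
Proof. by move=> r; apply/asboolP; exists 0%N, 0%N. Qed.

Lemma asymptotic_sym : symmetric asymptotic.
Proof.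
by move=> r s; apply/asboolP/asboolP=> -[m [k e]]; exists k, m => n; rewrite e.
Qed.

Lemma asymptotic_trans : transitive asymptotic.
Proof.
move=> s r t /asboolP[m [k e]] /asboolP[l [q f]]; apply/asboolP.
by exists (m + l)%N, (q + k)%N => n; rewrite -addnA e addnCA f addnA.
Qed.

Canonical asymptotic_equiv :=
  EquivRel asymptotic asymptotic_refl asymptotic_sym asymptotic_trans.

Definition ends := {eq_quot asymptotic}.
HB.instance Definition _ := Choice.on ends.

(* The cone topology on (the vertices of) T together with its ends.  The set
   cone_nbhs c m consists of the points p such that the geodesic from c 0 to p
   passes through c m.  For m > 0 this is the trace on vertices and ends of the
   basic neighbourhood U(c, r, e) = {p | d(p, c 0) > r, d(pr_r p, c r) < e} of
   the end of c, for m - 1 < r < m and e small (pr_r is the projection to the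
   ball of radius r around c 0).  Rays c from all base points are used, as the
   cone topology does not depend on the base point. *)
Definition cone_space : Type := (T + ends)%type.
HB.instance Definition _ := Choice.on cone_space.

Definition cone_nbhs (c : ray) (m : nat) : set cone_space := fun p =>
  match p with
  | inl y => segment (c 0%N) y (c m)
  | inr xi => exists r : ray, [/\ \pi_ends r = xi, r 0%N = c 0%N & r m = c m]
  end.

Definition cone_subbase : set (set cone_space) :=
  [set U | (exists y : T, U = [set inl y]) \/ (exists c m, U = cone_nbhs c m)].

HB.instance Definition _ :=
  @isSubBaseTopological.Build cone_space (set cone_space) cone_subbase id.

Definition vertex_point (x : T) : cone_space := inl x.
Definition end_point (xi : ends) : cone_space := inr xi.

Definition is_aut : pred (T -> T) := fun g =>
  `[< bijective g /\ forall x y, adj (g x) (g y) = adj x y >].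

Record aut := Aut { aut_fun :> T -> T; autP : is_aut aut_fun }.
HB.instance Definition _ := [isSub for aut_fun].
HB.instance Definition _ := [Choice of aut by <:].

Lemma aut_ext (g h : aut) : (forall x, g x = h x) -> g = h.
Proof. by move=> gh; apply/val_inj/funext. Qed.

Lemma aut_bij (g : aut) : bijective g.
Proof. by have /asboolP[] := autP g. Qed.

Lemma aut_adj (g : aut) x y : adj (g x) (g y) = adj x y.
Proof. by have /asboolP[_ ->] := autP g. Qed.

Lemma aut_one_subproof : is_aut id.
Proof. by apply/asboolP; split=> //; exists id. Qed.
Definition aut_one := Aut aut_one_subproof.

Lemma aut_mul_subproof (g h : aut) : is_aut (g \o h).
Proof.
apply/asboolP; split; first exact: bij_comp (aut_bij g) (aut_bij h).
by move=> x y /=; rewrite !aut_adj.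
Qed.
Definition aut_mul (g h : aut) := Aut (aut_mul_subproof g h).

Lemma aut_inv_exists (g : aut) :
  exists h : aut, (forall x, h (g x) = x) /\ (forall x, g (h x) = x).
Proof.
have [h gK hK] := aut_bij g.
suff hP : is_aut h by exists (Aut hP).
apply/asboolP; split; first by exists g.
by move=> x y; rewrite -(aut_adj g) !hK.
Qed.
Definition aut_inv (g : aut) : aut := projT1 (cid (aut_inv_exists g)).

Lemma autK (g : aut) x : aut_inv g (g x) = x.
Proof. by rewrite /aut_inv; case: cid => h []. Qed.
Lemma autKV (g : aut) x : g (aut_inv g x) = x.
Proof. by rewrite /aut_inv; case: cid => h []. Qed.

Lemma aut_mulA : associative aut_mul.
Proof. by move=> f g h; apply: aut_ext. Qed.
Lemma aut_mul1g : left_id aut_one aut_mul.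
Proof. by move=> g; apply: aut_ext. Qed.
Lemma aut_mulg1 : right_id aut_one aut_mul.
Proof. by move=> g; apply: aut_ext. Qed.
Lemma aut_mulVg : left_inverse aut_one aut_inv aut_mul.
Proof. by move=> g; apply: aut_ext => x /=; rewrite autK. Qed.
Lemma aut_mulgV : right_inverse aut_one aut_inv aut_mul.
Proof. by move=> g; apply: aut_ext => x /=; rewrite autKV. Qed.

HB.instance Definition _ := isGroup.Build aut
  aut_mulA aut_mul1g aut_mulg1 aut_mulVg aut_mulgV.

(* The compact-open topology of Aut(T), vertices being discrete; an automorphism
   is determined by its action on vertices, and the compact-open topology for
   the geometric realization is the same one. *)
Definition aut_map (g : aut) :
  {compact-open, discrete_topology T -> discrete_topology T} := aut_fun g.

HB.instance Definition _ := Topological.copy aut (initial_topology aut_map).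

Lemma dist_aut (g : aut) x y : dist (g x) (g y) = dist x y.
Proof.
suff le (h : aut) u v : (dist (h u) (h v) <= dist u v)%N.
  by apply/eqP; rewrite eqn_leq le -{1}(autK g x) -{1}(autK g y) le.
rewrite {2}/dist; case: ex_minnP => n /asboolP[p [up pv pn]] _.
rewrite /dist; case: ex_minnP => m _; apply; apply/asboolP.
exists (map h p); rewrite last_map pv size_map; split=> //.
by rewrite path_map (eq_path (e' := @adj T)) // => a b /=; rewrite aut_adj.
Qed.

Lemma ray_aut_subproof (g : aut) (r : ray) : is_ray (g \o r).
Proof.
apply/asboolP => i j ij /=; rewrite dist_aut.
by have /asboolP := rayP r; apply.
Qed.
Definition ray_aut (g : aut) (r : ray) := Ray (ray_aut_subproof g r).

Definition end_aut (g : aut) (xi : ends) : ends := \pi_ends (ray_aut g (repr xi)).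

Lemma end_autE (g : aut) (r : ray) : end_aut g (\pi_ends r) = \pi_ends (ray_aut g r).
Proof.
apply/eqmodP; have /eqmodP/asboolP[m [k e]] := reprK (\pi_ends r).
by apply/asboolP; exists m, k => n /=; rewrite e.
Qed.

Definition fixes_vertex (g : aut) := exists x, g x = x.

Definition is_line (l : int -> T) :=
  forall i j : int, dist (l i) (l j) = `|(i - j)%R|%N.

Definition hyperbolic (g : aut) :=
  exists2 l, is_line l & exists2 k : nat, (0 < k)%N & forall i, g (l i) = l (i + k%:Z)%R.

Definition is_subgroup (G : set aut) := group_closed (mem G).

(* The half-tree emanating from the edge {a, b} on the side of b; it contains
   the edge, hence a. *)
Definition half_tree (a b : T) : set T := a |` [set z | segment a z b].

Definition fixator (G : set aut) (A : set T) : set aut :=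
  [set g | G g /\ forall x, A x -> g x = x].

Definition tits_independence (G : set aut) := forall a b : T, adj a b ->
  fixator G [set a; b] =
  [set (g * h) | g in fixator G (half_tree b a) & h in fixator G (half_tree a b)].

Definition tends_to_infinity (G : set aut) (g_ : nat -> aut) :=
  forall K : set aut, K `<=` G -> compact K -> \forall n \near \oo, ~ K (g_ n).

Definition contracted (G : set aut) (g_ : nat -> aut) : set aut :=
  [set g | G g /\ (fun n => (g_ n)^-1 * g * g_ n) @ \oo --> (1 : aut)].

(* For G closed, the closure in Aut(T) is the closure in G. *)
Definition contracted_closure (G : set aut) (g_ : nat -> aut) : set aut :=
  closure (contracted G g_).

Definition end_fixator0 (G : set aut) (xi : ends) : set aut :=
  [set g | [/\ G g, end_aut g xi = xi & fixes_vertex g]].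

End Tree.

(* A complex Hilbert space: a complete normed space over C = R[i] whose norm
   comes from an inner product. *)
Record hilbert (R : realType) := Hilbert {
  hilbert_space :> completeNormedModType R[i];
  inner : {dot hilbert_space for Num.conj}%R;
  inner_norm : forall u, inner u u = (`|u| ^+ 2)%R
}.

Section Representation.
Variables (R : realType) (T : tree) (H : hilbert R).

Definition unitary (U : H -> H) :=
  [/\ linear U, bijective U & forall u v, inner H (U u) (U v) = inner H u v].

(* pi is a representation of the subgroup G; its values outside of G are
   irrelevant. *)
Record unitary_representation (G : set (aut T)) (pi : aut T -> H -> H) : Prop := {
  rep_unitary : forall g, G g -> unitary (pi g);
  rep_mul : forall g h, G g -> G h -> forall v, pi (g * h) v = pi g (pi h v);
  rep_continuous : forall v, {within G, continuous (fun g => pi g v)}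
}.

Definition weakly_converges (u_ : nat -> H) (u : H) :=
  forall w : H, (fun n => inner H (u_ n) w : R[i]^o) @ \oo --> (inner H u w : R[i]^o).

Definition stabilizer (G : set (aut T)) (pi : aut T -> H -> H) (v : H) : set (aut T) :=
  [set g | G g /\ pi g v = v].

End Representation.

(* Main.v *)
Require Import Defs.
From mathcomp Require Import all_boot all_order all_algebra sesquilinear.
From mathcomp Require Import all_classical all_reals all_analysis.
From mathcomp Require Import complex zify ring.

Import Order.TTheory GRing.Theory Num.Theory.
Import numFieldNormedType.Exports.
Local Open Scope classical_set_scope.
Local Open Scope quotient_scope.

(** Fix a vertex [x] and an end [xi] towards which [h_n x] converges, and let
    [r] be a ray towards [xi].

    The elements of [G_xi^0] are those which fix [r m] as soon as [2 m] is at
    least the displacement of [r 0] ([end_fixator0P]).  This is a closed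
    condition, and it holds for every [g] with [h_n^-1 g h_n --> 1]: such a [g]
    fixes [h_n x] for [n] large, hence also the last part of the geodesic from
    [r 0] to [h_n x], which follows [r] longer and longer ([contracted_sub]).
    This gives the first inclusion.

    For the second one, an element [g] of [G_xi^0] fixes the edge
    [r j, r (j + 1)] for [j] large, so that Tits' property writes it as [u h]
    with [u] trivial on the half-tree behind that edge and [h] trivial on the
    half-tree ahead of it.  The balls around [h_n x] eventually lie ahead of the
    edge, so [h] is contracted by [h_n]; and [h] agrees with [g] on a ball
    around [r 0] whose radius grows with [j].  Hence contracted elements are
    dense in [G_xi^0] ([end_fixator0_sub]).  By Mautner's argument a contracted
    element fixes the weak limit of [pi (h_n) v] ([mautner]), and stabilizers of
    vectors are closed ([closed_stabilizer]).

    For the last part, let [S] be the stabilizer of [v0].  An automorphism [f]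
    such that [f^2] moves some vertex [x] farther than [f] does is hyperbolic
    ([displacement_hyperbolic]).  Together with the four point condition this
    makes the displacement of [x] an ultrametric length function on a group
    without hyperbolic elements ([ultrametric_displacement]).  Since [S] is
    closed and not compact, its orbits are unbounded ([bounded_compact]); then
    the first halves of the geodesics from [x] to [g x], for [g] in [S], are
    nested and form a ray, and every element of [S] fixes this ray from some
    vertex on ([no_hyperbolic_fixes_ray]), so that [S] is contained in
    [G_eta^0] for the end [eta] of the ray.  Conversely, if [h_n] in [S] has
    displacement tending to infinity, then [h_n x] converges to [eta] and
    [pi (h_n) v0] is constant, so the second inclusion, applied to [h_n] and
    [v0], shows that [G_eta^0] is contained in [S]. *)

Set Implicit Arguments.
Unset Strict Implicit.
Unset Printing Implicit Defensive.

(** * The metric of a tree *)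

Section TreeMetric.
Variable T : tree.
Implicit Types x y z : T.

Lemma dist_path x y :
  exists p, [/\ path (@adj T) x p, last x p = y & size p = dist x y].
Proof. by rewrite /dist; case: ex_minnP => n /asboolP. Qed.

Lemma dist_le_size x p : path (@adj T) x p -> (dist x (last x p) <= size p)%N.
Proof.
move=> xp; rewrite /dist; case: ex_minnP => n _; apply.
by apply/asboolP; exists p.
Qed.

Lemma distxx x : dist x x = 0%N.
Proof. by apply/eqP; rewrite -leqn0; apply: (@dist_le_size x [::]). Qed.

Lemma dist_eq0 x y : dist x y = 0%N -> x = y.
Proof.
by have [p [_ py sp]] := dist_path x y => d0; case: p sp py; rewrite d0.
Qed.

Lemma dist_gt0 x y : x <> y -> (0 < dist x y)%N.
Proof. by rewrite lt0n => xy; apply/eqP => /dist_eq0. Qed.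

Lemma distC x y : dist x y = dist y x.
Proof.
suff le (u w : T) : (dist u w <= dist w u)%N by apply/eqP; rewrite eqn_leq !le.
have [p [wp pu <-]] := dist_path w u.
have lastw : last u (rev (belast w p)) = w.
  by case: p pu {wp} => [|a p] //= _; rewrite rev_cons last_rcons.
have up : path (@adj T) u (rev (belast w p)).
  rewrite -{1}pu rev_path (eq_path (e' := @adj T)) // => a b.
  by rewrite adj_sym.
by have := dist_le_size up; rewrite lastw size_rev size_belast.
Qed.

Lemma dist_triangle x y z : (dist x z <= dist x y + dist y z)%N.
Proof.
have [p [xp py <-]] := dist_path x y; have [q [yq qz <-]] := dist_path y z.
rewrite -size_cat -{1}qz -py -last_cat; apply: dist_le_size.
by rewrite cat_path xp py.
Qed.

Lemma dist_adj x y : adj x y -> dist x y = 1%N.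
Proof.
move=> xy; have /= := @dist_le_size x [:: y]; rewrite xy => /(_ isT).
have : x <> y by move=> e; rewrite e adj_irr in xy.
by move/dist_gt0; lia.
Qed.

(** The first step of a geodesic. *)
Lemma dist_step x y : x <> y -> exists2 z, adj x z & dist x y = (dist z y).+1.
Proof.
move=> xy; have [[|z p] [/= xp py sp]] := dist_path x y; first by [].
move: xp => /andP[xz zp]; exists z => //; have := dist_triangle x z y.
rewrite (dist_adj xz); have := dist_le_size zp; rewrite py; lia.
Qed.

(** A geodesic from a vertex [p] to [x] avoids every other vertex [y] which is
    at least as far from [x] as [p] is. *)
Lemma geodesic_avoids x y p : (dist x p <= dist x y)%N -> p <> y ->
  exists s, [/\ path (@adj T) p s, last p s = x & y \notin p :: s].
Proof.
move=> le py; have [s [ps sx ss]] := dist_path p x; exists s; split=> //.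
rewrite inE negb_or; apply/andP; split; first by apply/eqP => e; apply: py.
apply/negP => ys; case/splitPr: s / ys ps sx ss => s1 s2.
rewrite cat_path last_cat size_cat /= => /andP[_ /andP[_ ys2]] s2x.
have := dist_le_size ys2; rewrite s2x.
by have := distC x p; have := distC x y; lia.
Qed.

(** Acyclicity: a vertex has at most one neighbour which is not farther from
    [x] than itself, since two of them would close up to a cycle through [x]. *)
Lemma parent_unique x y p q : adj y p -> adj y q ->
  (dist x p <= dist x y)%N -> (dist x q <= dist x y)%N -> p = q.
Proof.
move=> yp yq lp lq; apply: contrapT => pq.
have neq z : adj y z -> z <> y by move=> yz e; rewrite e adj_irr in yz.
have [s [ps sx ys]] := geodesic_avoids lp (neq _ yp).
have [t [qt tx yt]] := geodesic_avoids lq (neq _ yq).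
(* the geodesic from [p] to [x] followed by the one from [x] to [q] *)
have pst : path (@adj T) p (s ++ rev (belast q t)).
  rewrite cat_path ps sx -tx rev_path -(eq_path (@adj_sym T)) //.
have lastst : last p (s ++ rev (belast q t)) = q.
  rewrite last_cat sx -tx; case: (t) => //= a t'.
  by rewrite rev_cons last_rcons.
have yst : y \notin p :: (s ++ rev (belast q t)).
  rewrite -cat_cons mem_cat negb_or ys mem_rev.
  by apply: contra yt => /mem_belast.
move: lastst; case: (shortenP pst) => r pr ur sr lastr.
have := @adj_acyclic T (y :: p :: r).
have -> : (2 < size (y :: p :: r))%N by case: r lastr {pr ur sr}.
move=> /(_ isT) /negP; apply; rewrite /ucycleb /=.
rewrite rcons_path yp pr /= lastr adj_sym yq /=.
rewrite -(cons_uniq p r) ur andbT.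
apply: contra yst; rewrite !inE => /orP[->//|/sr ->]; exact: orbT.
Qed.

(** Two adjacent vertices are never equidistant from a third one. *)
Lemma dist_adj_cases x y z : adj y z ->
  dist x y = (dist x z).+1 \/ dist x z = (dist x y).+1.
Proof.
move=> yz; have yz1 := dist_adj yz.
have := dist_triangle x y z; have := dist_triangle x z y.
rewrite (distC z y) yz1 => le1 le2.
(* if both were at the same distance from [x], then [z] and the neighbour of
   [y] closer to [x] would coincide *)
have [e|ne] := eqVneq (dist x y) (dist x z); last by move/eqP: ne; lia.
have [xy|/eqP xy] := eqVneq y x.
  move: e; rewrite xy distxx => /esym/dist_eq0 xz.
  by move: yz; rewrite xy -xz adj_irr.
have [p yp dp] := dist_step xy.
have := @parent_unique x y p z yp yz; rewrite !(distC x).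
move: e dp; rewrite !(distC x) => e dp h; have pz : p = z by apply: h; lia.
by move: dp; rewrite pz; lia.
Qed.

(** Removing the edge [a, b] separates the tree: a geodesic between vertices
    on different sides crosses it. *)
Lemma dist_across (a b u w : T) : adj a b -> dist u b = (dist u a).+1 ->
  dist w a = (dist w b).+1 -> dist u w = (dist u a + 1 + dist b w)%N.
Proof.
move=> ab; have [n] := ubnP (dist u w); elim: n u => // n IH u lt ub wa.
have [uw|/eqP uw] := eqVneq u w; first by move: wa ub; rewrite uw; lia.
have [z uz dz] := dist_step uw.
have za := dist_triangle u a w; have aw := dist_triangle a b w.
have [zb|zb] : dist z b = (dist z a).+1 \/ dist z a = (dist z b).+1.
- have [] := dist_adj_cases z ab; lia.
- have := IH z _ zb wa; have := dist_triangle u z a.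
  rewrite (dist_adj uz) (dist_adj ab) in aw *; lia.
have [ua|/eqP ua] := eqVneq u a.
  (* [z] is on the side of [b] and adjacent to [a], so it is [b] *)
  move: uz; rewrite ua => az; have az1 := dist_adj az.
  have : dist z b = 0%N by move: zb; rewrite (distC z a); lia.
  by move=> /dist_eq0 e; move: dz; rewrite ua e distxx; lia.
(* otherwise [z] and the neighbour [t] of [u] towards [a] are both closer to
   [b] than [u] is, so [z = t]; but only [t] is closer to [a] than [u] *)
have [t ut dt] := dist_step ua.
have : t = z.
  apply: (@parent_unique b u) => //.
    have := dist_adj_cases t ab; have := dist_triangle t a b.
    by rewrite (dist_adj ab) !(distC b); lia.
  rewrite !(distC b); have := dist_triangle u z a; have := dist_triangle z u a.
  have := dist_adj_cases a uz.
  have := dist_triangle u z b.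
  rewrite (distC z u) (dist_adj uz) !(distC a); lia.
move=> tz; move: dt; rewrite tz; have := dist_triangle u z b.
rewrite (dist_adj uz); lia.
Qed.

(** The four point condition: a tree is 0-hyperbolic. *)
Lemma four_point (a b c d : T) :
  (dist a c + dist b d <= maxn (dist a b + dist c d) (dist a d + dist b c))%N.
Proof.
have [n] := ubnP (dist a b); elim: n a => // n IH a lt.
have [ab|/eqP ab] := eqVneq a b; first by rewrite ab distxx; lia.
(* replace [a] by its neighbour [e] towards [b]; the induction hypothesis may
   only fail to suffice when the edge [a, e] separates [d] from [b] and [c],
   and then [dist a c + dist b d = dist a b + dist c d] *)
have [e ae de] := dist_step ab.
have := IH e; have ea := dist_adj ae.
have [dc|dc] := dist_adj_cases c ae; have [dd|dd] := dist_adj_cases d ae;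
  rewrite !(distC a) !(distC e) in de lt *; try lia.
have eb : dist b a = (dist b e).+1 by rewrite !(distC b) distC de distC.
have := dist_across ae dd dc; have := dist_across ae dd eb.
rewrite !(distC d) !(distC e); lia.
Qed.
End TreeMetric.

(** * Geodesics and hyperbolic automorphisms *)

Section Geodesics.
Variable T : tree.
Implicit Types x y z : T.

Lemma dist_between x y i : (i <= dist x y)%N ->
  exists2 z, dist x z = i & dist z y = (dist x y - i)%N.
Proof.
elim: i x => [|i IH] x le; first by exists x; rewrite ?distxx ?subn0.
have xy : x <> y by move=> e; move: le; rewrite e distxx.
have [w xw dw] := dist_step xy.
have [|z wz zy] := IH w; first by lia.
exists z; last by lia.
have := dist_triangle x w z; have := dist_triangle x z y.
rewrite (dist_adj xw); lia.
Qed.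

(** Two geodesics issued from [x] agree as long as the Gromov product of their
    endpoints allows it. *)
Lemma branch_unique x (a b p q : T) :
  (dist x p + dist p a = dist x a)%N -> (dist x q + dist q b = dist x b)%N ->
  dist x p = dist x q -> (2 * dist x p + dist a b <= dist x a + dist x b)%N ->
  p = q.
Proof.
move=> pa qb pq le; apply: dist_eq0.
have := four_point x p a b; have := four_point x p b q.
rewrite (distC b q); lia.
Qed.

Lemma geodesic_unique x y p q : (dist x p + dist p y = dist x y)%N ->
  (dist x q + dist q y = dist x y)%N -> dist x p = dist x q -> p = q.
Proof.
move=> pa qb pq; apply: (branch_unique pa qb pq); rewrite distxx; lia.
Qed.

(** Local geodesics are geodesics. *)
Lemma dist_chain (a b c d : T) : b <> c ->
  (dist a c = dist a b + dist b c)%N -> (dist b d = dist b c + dist c d)%N ->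
  (dist a d = dist a b + dist b c + dist c d)%N.
Proof.
move=> /dist_gt0 bc ac bd; have := four_point a b c d.
have := dist_triangle a c d; lia.
Qed.

Lemma dist_geodesic x y p q : (dist x p + dist p y = dist x y)%N ->
  (dist x q + dist q y = dist x y)%N -> (dist x p <= dist x q)%N ->
  dist p q = (dist x q - dist x p)%N.
Proof.
move=> xp xq pq; have := four_point x p y q; have := dist_triangle x p q.
rewrite (distC y q); lia.
Qed.

Lemma geodesic_exists x y : exists q : nat -> T,
  [/\ q 0%N = x, q (dist x y) = y &
   forall i j, (i <= j <= dist x y)%N -> dist (q i) (q j) = (j - i)%N].
Proof.
have /choice[q qP] : forall i, exists z, (i <= dist x y)%N ->
    dist x z = i /\ dist z y = (dist x y - i)%N.
  move=> i; have [le|lt] := leqP i (dist x y); last by exists x.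
  by have [z xz zy] := dist_between le; exists z.
exists q; split.
- by have [//|/dist_eq0] := qP 0%N.
- by have [//|_] := qP (dist x y); rewrite subnn => /dist_eq0.
move=> i j ij; have [|xi iy] := qP i; first lia.
have [|xj jy] := qP j; first lia.
by rewrite (@dist_geodesic x y); lia.
Qed.

Lemma local_geodesic (s : nat -> T) :
  (forall i, dist (s i) (s i.+1) = 1%N) ->
  (forall i, dist (s i) (s i.+2) = 2) ->
  forall i j, (i <= j)%N -> dist (s i) (s j) = (j - i)%N.
Proof.
move=> s1 s2 i j /subnK <-; rewrite addnK addnC.
suff [//] : dist (s i) (s (i + (j - i))%N) = (j - i)%N /\
          dist (s i) (s (i + (j - i)).+1) = (j - i).+1.
elim: (j - i)%N => [|k [IH1 IH2]]; first by rewrite addn0 distxx s1.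
rewrite addnS; split=> //.
have ne : s (i + k)%N <> s (i + k).+1.
  by move=> e; have := s1 (i + k)%N; rewrite e distxx.
rewrite (dist_chain ne); rewrite ?IH1 ?IH2 ?s1 ?s2 //; lia.
Qed.

(** Trees are bipartite: triangles have even perimeter. *)
Lemma tree_triangle_even x y z : ~~ odd (dist x y + dist y z + dist x z).
Proof.
have [n] := ubnP (dist y z); elim: n y => // n IH y lt.
have [->|/eqP yz] := eqVneq y z; first by rewrite distxx addn0 addnn odd_double.
have [w yw dw] := dist_step yz.
have := IH w; have := dist_adj_cases x yw; lia.
Qed.
End Geodesics.

Section Automorphisms.
Variable T : tree.
Implicit Types (f g h : aut T) (x y z : T).

Lemma autM g h x : (g * h)%g x = g (h x). Proof. by []. Qed.
Lemma autVK g x : (g^-1)%g (g x) = x. Proof. exact: autK. Qed.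
Lemma autVKV g x : g ((g^-1)%g x) = x. Proof. exact: autKV. Qed.
Lemma distVl g x y : dist ((g^-1)%g x) y = dist x (g y).
Proof. by rewrite -(dist_aut g) autVKV. Qed.

Lemma dist_iter f k x y : dist (iter k f x) (iter k f y) = dist x y.
Proof. by elim: k => //= k <-; rewrite dist_aut. Qed.

(** An automorphism [f] whose orbit of [y] is aligned for one step translates
    the line obtained by concatenating the images of the geodesic from [y] to
    [f y]. *)
Lemma aligned_hyperbolic f y : (0 < dist y (f y))%N ->
  dist y (f (f y)) = (dist y (f y)).*2 -> hyperbolic f.
Proof.
set n := dist y (f y) => n0 d2.
have [q [q0 q2 dq]] := geodesic_exists y (f (f y)); rewrite d2 in q2 dq.
have dy r : (r <= n.*2)%N -> dist y (q r) = r.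
  by move=> r2; rewrite -{1}q0 dq ?subn0.
have dfy r : (r <= n.*2)%N -> dist (q r) (f (f y)) = (n.*2 - r)%N.
  by move=> r2; rewrite -q2 dq // r2 leqnn.
have qn : q n = f y.
  have ffy := dist_aut f y (f y); rewrite -/n in ffy.
  have dyn := dy n; have dfyn := dfy n.
  by apply: (@geodesic_unique _ y (f (f y))); lia.
have qf r : (r <= n)%N -> q (r + n)%N = f (q r).
  move=> rn; have yr := dy r; have ry := dfy (r + n)%N.
  have nr := dq n (r + n)%N; have rn' := dq r n; rewrite qn in nr rn'.
  have e1 := dist_aut f y (q r); have e2 := dist_aut f (q r) (f y).
  have e3 := dist_aut f y (f y); rewrite -/n in e3.
  by apply: (@geodesic_unique _ (f y) (f (f y))); lia.
(* [s] is the ray made of the translates of the geodesic from [y] to [f y] *)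
pose s i := iter (i %/ n) f (q (i %% n)%N).
have sf i : s (i + n)%N = f (s i) by rewrite /s divnDr // divnn n0 addn1 modnDr.
have sfk k i : s (i + k * n)%N = iter k f (s i).
  elim: k => [|k IH]; first by rewrite addn0.
  by rewrite mulSn addnCA addnC sf IH.
have sq r : (r <= n.*2)%N -> s r = q r.
  have [m] := ubnP r; elim: m r => // m IH r rm r2.
  have [rn|nr] := ltnP r n; first by rewrite /s divn_small // modn_small.
  by rewrite -(subnK nr) sf IH ?qf //; lia.
have sE i j : (j <= 2)%N -> dist (s i) (s (i + j)%N) = j.
  move=> j2; have := ltn_pmod i n0 => r.
  have iE : i = (i %% n + i %/ n * n)%N by rewrite addnC -divn_eq.
  by rewrite iE addnAC !sfk dist_iter !sq ?dq; lia.
have ds : forall i j, (i <= j)%N -> dist (s i) (s j) = (j - i)%N.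
  by apply: local_geodesic => i; [rewrite -addn1 sE|rewrite -addn2 sE].
pose F := aut_inv f.
have FK k x : iter k F (iter k f x) = x.
  by elim: k x => // k IH x; rewrite iterSr /= /F autK IH.
(* the line is obtained by pushing [s] back by negative powers of [f]; its
   value at [z] does not depend on the power, provided it is large enough *)
pose sh (z : int) (k : nat) := absz (z + Posz k)%R.
pose l (z : int) := iter `|z|%N F (s (sh z (`|z| * n)%N)).
have lE (z : int) M : (`|z| <= M)%N -> l z = iter M F (s (sh z (M * n)%N)).
  move=> zM; rewrite /l -(subnK zM) addnC.
  rewrite iterD mulnDl.
  have -> : sh z (`|z| * n + (M - `|z|) * n)%N =
      (sh z (`|z| * n) + (M - `|z|) * n)%N by rewrite /sh; nia.
  by rewrite sfk FK.
have dF k (a b : T) : dist (iter k F a) (iter k F b) = dist a b.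
  exact: dist_iter.
exists l.
  move=> i j; have [Mi Mj] := (leq_maxl `|i| `|j|, leq_maxr `|i| `|j|).
  rewrite (lE _ _ Mi) (lE _ _ Mj) dF; move: (maxn _ _) Mi Mj => M Mi Mj.
  have iM : (`|i| <= M * n)%N by nia.
  have jM : (`|j| <= M * n)%N by nia.
  move: (M * n)%N iM jM => N iN jN.
  have [le|lt] := leqP (sh i N) (sh j N).
    by rewrite ds //; rewrite /sh in le *; lia.
  by rewrite distC ds; rewrite /sh in lt *; lia.
exists n => // i.
rewrite (@lE i (`|i| + n).+1) ?(@lE (i + Posz n)%R (`|i| + n).+1); try lia.
rewrite /= -/F; rewrite autKV.
have -> : sh (i + Posz n)%R ((`|i| + n).+1 * n)%N =
   (sh i ((`|i| + n).+1 * n) + n)%N by rewrite /sh; nia.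
by rewrite sf -iterS iterSr autK.
Qed.

(** An automorphism [f] such that [f^2] moves some vertex [x] farther than [f]
    does is hyperbolic: its axis contains the middle part of the geodesic from
    [x] to [f x]. *)
Lemma displacement_hyperbolic f x :
  (dist x (f x) < dist x (f (f x)))%N -> hyperbolic f.
Proof.
set n := dist x (f x); set m := dist x (f (f x)) => nm.
have ev := tree_triangle_even x (f x) (f (f x)).
have tr := dist_triangle x (f x) (f (f x)).
rewrite dist_aut -/n -/m in ev tr.
(* [t] is the Gromov product of [x] and [f^2 x] at [f x]; the axis passes
   through the point [y] at distance [t] from [x] on the geodesic to [f x] *)
pose t := (n - m./2)%N.
have t2 : (t.*2 = n.*2 - m)%N by lia.
have [|y xy yf] := @dist_between _ x (f x) t; first by rewrite -/n; lia.
rewrite -/n in yf.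
have [|z xz zf] := @dist_between _ x (f x) (n - t); first by rewrite -/n; lia.
rewrite -/n in zf.
have fxy : dist (f x) (f y) = t by rewrite dist_aut.
have fyf : dist (f y) (f (f x)) = (n - t)%N by rewrite dist_aut.
have fxx : dist (f x) x = n by rewrite distC.
have fx2 : dist (f x) (f (f x)) = n by rewrite dist_aut.
have mE : dist (f (f x)) x = m by rewrite distC.
have zE : dist (f x) z = t by rewrite distC; lia.
have zE' : dist z x = (n - t)%N by rewrite distC.
have fyz : f y = z.
  by apply: (@branch_unique _ (f x) (f (f x)) x); lia.
have yfy : dist y (f y) = (m - n)%N.
  rewrite fyz; have := four_point x y (f x) z; have := dist_triangle x y z.
  rewrite -/n; lia.
have xfy : dist x (f y) = (n - t)%N by rewrite fyz.
have ffy : dist (f (f y)) (f (f x)) = t by rewrite !dist_aut distC.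
have := dist_aut f y (f y); rewrite yfy => yfy2.
apply: (@aligned_hyperbolic f y); rewrite yfy; first lia.
have := dist_triangle x y (f (f x)).
have := dist_triangle y (f (f y)) (f (f x)).
have := dist_triangle y (f y) (f (f y)); rewrite -/m; lia.
Qed.
End Automorphisms.

(** * Groups without hyperbolic elements *)

Section NoHyperbolic.
Variable T : tree.
Implicit Types (f g h : aut T) (x y z : T) (r : ray T).

Lemma not_hyperbolic_displacement f x :
  ~ hyperbolic f -> (dist x (f (f x)) <= dist x (f x))%N.
Proof.
by move=> hf; rewrite leqNgt; apply/negP => /displacement_hyperbolic.
Qed.

(** In the absence of hyperbolic elements the displacement of a vertex is an
    ultrametric length function. *)
Lemma ultrametric_displacement g h x :
  ~ hyperbolic g -> ~ hyperbolic h -> ~ hyperbolic (g^-1 * h)%g ->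
  (dist (g x) (h x) <= maxn (dist x (g x)) (dist x (h x)))%N.
Proof.
move=> /(@not_hyperbolic_displacement _ x) hg.
move=> /(@not_hyperbolic_displacement _ x) hh.
move=> /(@not_hyperbolic_displacement _ x); rewrite !autM => hgh.
pose a := g x; pose a' := g^-1%g x; pose b := h x; pose b' := h^-1%g x.
pose c := h^-1%g (g x); pose c' := g^-1%g (h x).
have xa' : dist x a' = dist x a by rewrite distC distVl.
have xb' : dist x b' = dist x b by rewrite distC distVl.
have xc' : dist x c' = dist a b by rewrite distC distVl distC.
have cx : dist c x = dist a b by rewrite distVl.
have aa' : (dist a a' <= dist x a)%N by rewrite distC distVl.
have bb' : (dist b b' <= dist x b)%N by rewrite distC distVl.
have cb' : dist c b' = dist x a by rewrite dist_aut distC.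
have a'c' : dist a' c' = dist x b by rewrite dist_aut.
have cc' : (dist c c' <= dist a b)%N.
  have E : dist c c' = dist x (g^-1%g (h c')).
    by rewrite distVl [RHS]distC distVl distC.
  by rewrite E -xc'.
(* Suppose that [dist a b] exceeds both displacements.  As [g^2] does not move
   [x] farther than [g], the points [a] and [a'] lie in the same direction from
   [x] up to half the displacement, and likewise [b] and [b'].  Hence [a'] and
   [b'] are at least as far apart as [a] and [b].  It follows that [dist c c'],
   which is the displacement of [x] under [(g^-1 h)^2], exceeds the one under
   [g^-1 h]. *)
have := four_point a x b a'; have := four_point b x a' b'.
have := four_point c b' x a'; have := four_point c x a' c'.
have := distC b' a'; have := distC b' x; have := distC a' x.
have := distC a x; have := distC b x; have := distC c' x.
rewrite -/a -/b; lia.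
Qed.

Lemma subgroupP (S : set (aut T)) : is_subgroup S ->
  [/\ S 1%g, forall g, S g -> S g^-1%g & forall g h, S g -> S h -> S (g * h)%g].
Proof.
move=> Sg; have [S1 _] := Sg; split; first by move: S1; rewrite inE.
- move=> g Gg; have := @group_closedV _ _ Sg g; rewrite !inE; exact.
- move=> g h Gg Gh; have := @group_closedM _ _ Sg g h; rewrite !inE; exact.
Qed.

(** A group without hyperbolic elements and with unbounded orbits fixes an end;
    more precisely all its elements fix a ray towards this end, eventually. *)
Lemma no_hyperbolic_fixes_ray (S : set (aut T)) x : is_subgroup S ->
  (forall g, S g -> ~ hyperbolic g) ->
  (forall n, exists2 g, S g & (n <= dist x (g x))%N) ->
  exists r : ray T, [/\ r 0%N = x,
    forall g m, S g -> (m.*2 <= dist x (g x))%N -> segment x (g x) (r m) &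
    forall g m, S g -> (dist x (g x) <= m.*2)%N -> g (r m) = r m].
Proof.
move=> /subgroupP[S1 SV SM] nohyp unb.
have ult g h : S g -> S h ->
    (dist (g x) (h x) <= maxn (dist x (g x)) (dist x (h x)))%N.
  move=> Sg Sh; apply: ultrametric_displacement; apply: nohyp => //.
  by apply: SM => //; apply: SV.
(* the [n]-th vertex of the ray lies on the geodesic from [x] to [g x] for some,
   hence by [seg] for every [g] in [S] of displacement at least [2 n] *)
have /choice[r0 r0P] : forall n, exists y, exists g,
    [/\ S g, (n.*2 <= dist x (g x))%N, dist x y = n & segment x (g x) y].
  move=> n; have [g Sg ng] := unb n.*2.
  have [|y xy yg] := @dist_between _ x (g x) n; first lia.
  by exists y, g; split=> //; rewrite /segment /= xy yg; lia.
have r0d n : dist x (r0 n) = n by have [g []] := r0P n.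
have seg g m : S g -> (m.*2 <= dist x (g x))%N -> segment x (g x) (r0 m).
  move=> Sg mg; have [h [Sh mh xm mseg]] := r0P m.
  have [|y xy yg] := @dist_between _ x (g x) m; first lia.
  suff -> : r0 m = y by rewrite /segment /= xy yg; lia.
  rewrite /segment /= in mseg; have := ult h g Sh Sg => le.
  by apply: (@branch_unique _ x (h x) (g x)); lia.
have rayr : is_ray r0.
  apply/asboolP => i j ij; have [g [Sg jg xj jseg]] := r0P j.
  have iseg : segment x (g x) (r0 i) by apply: seg => //; lia.
  rewrite /segment /= in jseg iseg.
  by rewrite (@dist_geodesic _ x (g x) _ _ iseg jseg) ?r0d.
exists (Ray rayr); split=> //=; first by rewrite -(dist_eq0 (r0d 0%N)).
(* compare the geodesics from [x] and [g x] to [h x], with [h] of larger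
   displacement than [g]: they have the same length by the ultrametric
   inequality *)
move=> g m Sg gm; have [h Sh hm] := unb (maxn m.*2 (dist x (g x)).+1).
have Sk : S (g^-1 * h)%g by apply: SM => //; apply: SV.
have gh := ult g h Sg Sh.
have kE : dist x ((g^-1 * h)%g x) = dist (g x) (h x).
  by rewrite autM distC distVl distC.
have hg : (dist x (h x) <= maxn (dist x (g x)) (dist (g x) (h x)))%N.
  have := ult _ _ (SV _ Sg) Sk.
  rewrite kE distVl [in dist x (g^-1%g x)]distC distVl.
  by rewrite !autM autVKV.
have hs : segment x (h x) (r0 m) by apply: seg => //; lia.
have ks : segment x ((g^-1 * h)%g x) (r0 m).
  by apply: seg => //; rewrite kE; lia.
rewrite /segment /= r0d in hs; rewrite /segment /= kE r0d in ks.
have := dist_aut g x (r0 m); have := dist_aut g (r0 m) ((g^-1 * h)%g x).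
rewrite autM autVKV r0d => e1 e2.
have e3 := distC (h x) (g x); have e4 := distC (h x) x.
have e5 := distC (h x) (r0 m); have e6 := distC (h x) (g (r0 m)).
have e7 := distC (g (r0 m)) (g x); have e8 := distC (r0 m) x; rewrite r0d in e8.
have e9 := distC x (g x).
by apply: (@branch_unique _ (h x) (g x) x); lia.
Qed.
End NoHyperbolic.

(** * Rays, ends and half-trees *)

(** A sequence growing at least linearly cannot be invariant under a nonzero
    shift. *)
Lemma periodic_shift_eq (D : nat -> nat) (a b C : nat) :
  (forall n, D (a + n)%N = D (b + n)%N) -> (forall n, (n <= D n + C)%N) ->
  a = b.
Proof.
move=> per lb; wlog ab : a b per / (a < b)%N.
  have [| |//] := ltngtP a b => lt h; [|symmetry]; apply: h => // n;
    rewrite per.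
have perk k : D (a + k * (b - a))%N = D a.
  elim: k => [|k <-]; first by rewrite addn0.
  by rewrite [RHS]per; congr D; rewrite mulSn; lia.
have := lb (a + (D a + C).+1 * (b - a))%N; rewrite perk; nia.
Qed.

Section RaysAndEnds.
Variable T : tree.
Implicit Types (f g h : aut T) (x y z : T) (r : ray T).

Lemma dist1_adj x y : dist x y = 1%N -> adj x y.
Proof.
move=> d1; have xy : x <> y by move=> e; rewrite e distxx in d1.
by have [z xz] := dist_step xy; rewrite d1 => -[/esym/dist_eq0 <-].
Qed.

Lemma dist_ray r i j : (i <= j)%N -> dist (r i) (r j) = (j - i)%N.
Proof. by move=> ij; have /asboolP := rayP r; apply. Qed.

Lemma dist_ray0 r i : dist (r 0%N) (r i) = i.
Proof. by rewrite dist_ray ?subn0. Qed.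

Lemma adj_ray r i : adj (r i) (r i.+1).
Proof. by apply: dist1_adj; rewrite dist_ray // subSnn. Qed.

(** If [g] fixes [c], then the fixed points of [g] on the geodesic from [x] to
    [c] fill at least the part beyond half the displacement of [x]. *)
Lemma fix_on_segment g x y c : g c = c -> segment x c y ->
  (dist x (g x) <= (dist x y).*2)%N -> g y = y.
Proof.
rewrite /segment /= => gc xyc le.
have := dist_aut g x y; have := dist_aut g y c; have := dist_aut g x c.
rewrite gc => e1 e2 e3.
have e4 := distC (g y) c; have e5 := distC (g x) c.
have e6 := distC (g y) (g x).
have e7 := distC y c; have e8 := distC x c; have e9 := distC x y.
have e10 := distC x (g x).
by apply: (@branch_unique _ c (g x) x); lia.
Qed.

(** An elliptic element [g] fixing the end of [r] eventually fixes [r]. *)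
Lemma end_fixed_ray g r z :
  end_aut g (\pi_(ends T) r) = \pi_(ends T) r -> g z = z ->
  forall m, (dist (r 0%N) (g (r 0%N)) <= m.*2)%N -> g (r m) = r m.
Proof.
rewrite end_autE => /eqmodP/asboolP[a [b /= e]] gz m le.
(* [g] cannot translate [r], because it preserves the distance to [z] *)
have ab : a = b.
  apply: (@periodic_shift_eq (fun n => dist z (r n)) a b (dist (r 0%N) z)) => n.
    by rewrite -e -(dist_aut g z) gz.
  by have := dist_triangle (r 0%N) z (r n); rewrite dist_ray0; lia.
apply: (@fix_on_segment g (r 0%N) _ (r (b + m)%N)); first by rewrite -{1}ab e.
  by rewrite /segment /= !dist_ray0 dist_ray; lia.
by rewrite dist_ray0.
Qed.

Lemma ray_fixed_end g r M : (forall m, (M <= m)%N -> g (r m) = r m) ->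
  end_aut g (\pi_(ends T) r) = \pi_(ends T) r.
Proof.
move=> gr; rewrite end_autE; apply/eqmodP/asboolP.
by exists M, M => n /=; rewrite gr // leq_addr.
Qed.

(** A ball around the origin of a ray lies in the half-trees behind the ray. *)
Lemma half_tree_behind r j z :
  (dist (r 0%N) z <= j)%N -> half_tree (r j.+1) (r j) z.
Proof.
move=> le; right; rewrite /segment /=.
have e := dist_adj (adj_ray r j); rewrite (distC (r j.+1) (r j)) e.
have [h|h] := dist_adj_cases z (adj_ray r j); last first.
  by have := distC z (r j); have := distC z (r j.+1); lia.
have ne : r j <> r j.+1 by move=> ej; rewrite ej distxx in e.
have := @dist_chain _ (r 0%N) (r j) (r j.+1) z ne; rewrite !dist_ray0 e.
have := distC z (r j); have := distC z (r j.+1); lia.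
Qed.

(** A ball around a point whose geodesic from the origin of a ray follows the
    ray long enough lies in the half-tree ahead. *)
Lemma half_tree_ahead r j y z :
  segment (r 0%N) y (r (j.+1 + dist y z)%N) -> half_tree (r j) (r j.+1) z.
Proof.
rewrite /segment /= dist_ray0 => seg; right; rewrite /segment /=.
have e := dist_adj (adj_ray r j); rewrite e.
have [h|h] := dist_adj_cases z (adj_ray r j).
  by have := distC z (r j); have := distC z (r j.+1); lia.
have ne : r j <> r j.+1 by move=> ej; rewrite ej distxx in e.
have := @dist_chain _ z (r j) (r j.+1) y ne; rewrite e.
have j1 := dist_triangle (r j.+1) (r (j.+1 + dist y z)%N) y.
rewrite dist_ray ?leq_addr // in j1.
have := dist_triangle (r 0%N) (r j.+1) y; have := dist_triangle (r 0%N) (r j) y.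
have := dist_triangle (r j) (r j.+1) y.
have := distC y z; rewrite !dist_ray0 e; lia.
Qed.
End RaysAndEnds.

(** * The topology of the automorphism group *)

Lemma ultra_finite_fiber (S : Type) (U : choiceType) (F : set_system S)
    (u : S -> U) (A : set U) :
  UltraFilter F -> finite_set A -> F [set s | A (u s)] ->
  exists z, F [set s | u s = z].
Proof.
move=> FU /finite_seqP[s ->]; elim: s => [|z s IH] Fs.
  by have [a] := filter_ex Fs; rewrite /= inE.
have [Fz|Fz] := in_ultra_setVsetC [set t | u t = z] FU; first by exists z.
apply: IH; apply: (filterS _ (filterI Fs Fz)) => t [/=].
by rewrite inE => /orP[/eqP|].
Qed.

Section AutTopology.
Variable T : tree.
Implicit Types (f g h : aut T) (x y z : T) (r : ray T).

Let co := {compact-open, discrete_topology T -> discrete_topology T}.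

Lemma nbhs_aut f x : nbhs f [set g : aut T | g x = f x].
Proof.
have cont : {for f, continuous (@aut_map T)} by apply: initial_continuous.
have : nbhs (aut_map f : co) [set u : co | u @` [set x] `<=` [set f x]].
  apply: open_nbhs_nbhs; split; last by move=> _ [y -> <-].
  by apply: compact_open_open; [exact: compact_set1|exact: discrete_open].
move=> /cont fU.
have {}fU :
    nbhs f (@aut_map T @^-1` [set u : co | u @` [set x] `<=` [set f x]]).
  exact: fU.
apply: (@filterS _ (nbhs f) _ _ _ _ fU) => g gf; apply: gf.
by exists x.
Qed.

(** The compact-open topology is that of pointwise convergence. *)
Lemma aut_cvgP (F : set_system (aut T)) f : Filter F ->
  (F --> f <-> forall x, F [set g : aut T | g x = f x]).
Proof.
move=> FF; split=> [Ff x|Fx]; first exact: Ff (nbhs_aut f x).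
move=> A [_ [[B oB <-] Bf BA]]; apply: (filterS BA).
have cvg : (@aut_map T @ F : set_system co) --> (aut_map f : co).
  apply/compact_open_cvgP => K O /compact_near_coveringP cK _ KO.
  have := cK (aut T) F (fun g y => O (aut_map g y)) FF.
  have h : forall x, K x ->
      \forall x' \near (x : discrete_topology T) & g \near F, O (aut_map g x').
    move=> x Kx.
    exists ([set x : discrete_topology T], [set g : aut T | g x = f x]).
      by split; [exact: discrete_set1|exact: Fx].
    move=> [y g] [/= -> gx]; apply: KO; exists x => //; exact: esym gx.
  move=> /(_ h); rewrite !nbhs_simpl; apply: filterS => g gO _ [y Ky <-].
  exact: gO.
have : nbhs (aut_map f : co) B by exact: open_nbhs_nbhs.
by move/cvg.
Qed.

Lemma closure_autP (K : set (aut T)) f x :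
  (forall n, exists2 g, K g & forall y, (dist x y <= n)%N -> g y = f y) ->
  closure K f.
Proof.
move=> approx B nB.
have /choice[g_ g_P] : forall n, exists g, K g /\
    forall y, (dist x y <= n)%N -> g y = f y.
  by move=> n; have [g Kg gf] := approx n; exists g.
have cvg : (g_ @ \oo : set_system (aut T)) --> f.
  apply/aut_cvgP => y; exists (dist x y) => // n /= yn; exact: (g_P n).2 y yn.
have [n _ nBg] := cvg B nB; exists (g_ n).
by split; [exact: (g_P n).1|exact: nBg n (leqnn n)].
Qed.

Lemma closure_aut2 (K : set (aut T)) f x y : closure K f ->
  exists2 g, K g & g x = f x /\ g y = f y.
Proof.
move=> cl.
have [g [Kg [gx gy]]] := cl _ (filterI (nbhs_aut f x) (nbhs_aut f y)).
by exists g.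
Qed.

Lemma finite_ball x n : locally_finite T ->
  finite_set [set y | (dist x y <= n)%N].
Proof.
move=> lf; elim: n => [|n IH].
  apply: (sub_finite_set _ (finite_set1 x)) => y /=.
  by rewrite leqn0 => /eqP/dist_eq0 ->.
have fin : finite_set
    (\bigcup_(y in [set y | (dist x y <= n)%N]) [set z | adj y z]).
  by apply: bigcup_finite => // y _; apply: lf.
have := conj IH fin; rewrite -finite_setU; apply: sub_finite_set => y /= yn.
have [->|/eqP yx] := eqVneq y x; first by left; rewrite /= distxx.
have [z yz dz] := dist_step yx; right; exists z; last by rewrite /= adj_sym.
by rewrite /= distC; have := distC x y; lia.
Qed.

(** A closed set of automorphisms with bounded orbits is compact. *)
Lemma bounded_compact (K : set (aut T)) x n : locally_finite T -> closed K ->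
  (forall g, K g -> (dist x (g x) <= n)%N) -> compact K.
Proof.
move=> lf cK bK; rewrite compact_ultra => F FU FK.
(* along an ultrafilter the values of [g] and of [g^-1] at each vertex, which
   stay in a finite ball, are eventually constant *)
have lim (v : aut T -> T -> T) :
    (forall g y, K g -> (dist x (v g y) <= n + dist x y)%N) ->
    exists phi : T -> T, forall y, F [set g | v g y = phi y].
  move=> bv.
  suff /choice[phi phiP] : forall y, exists z, F [set g | v g y = z].
    by exists phi.
  move=> y.
  apply: (ultra_finite_fiber FU (finite_ball x (n + dist x y) lf)).
  by apply: (filterS _ FK) => g Kg /=; apply: bv.
have [phi Fphi] : exists phi : T -> T, forall y, F [set g | g y = phi y].
  apply: lim => g y Kg; have := bK g Kg; have := dist_triangle x (g x) (g y).
  rewrite dist_aut; lia.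
have [psi Fpsi] :
    exists psi : T -> T, forall y, F [set g | aut_inv g y = psi y].
  apply: lim => g y Kg; have := bK g Kg; have := dist_triangle (g x) x y.
  by have := dist_aut g x (aut_inv g y); rewrite autKV (distC (g x) x); lia.
have autphi : is_aut phi.
  apply/asboolP; split.
    exists psi => y.
      have [g [/= gy gphi]] := filter_ex (filterI (Fphi y) (Fpsi (phi y))).
      by rewrite -gphi -gy autK.
    have [g [/= gy gpsi]] := filter_ex (filterI (Fpsi y) (Fphi (psi y))).
    by rewrite -gpsi -gy autKV.
  move=> y z; have [g [/= gy gz]] := filter_ex (filterI (Fphi y) (Fphi z)).
  by rewrite -gy -gz aut_adj.
have Fcvg : F --> (Aut autphi : aut T) by apply/aut_cvgP.
exists (Aut autphi); split=> //; apply: cK => B /Fcvg FB.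
exact: filter_ex (filterI FK FB).
Qed.

(** Without reference to the end: [g] is elliptic and fixes the end of [r] if
    and only if it fixes [r m] for all [m] beyond half the displacement of the
    origin of [r]. *)
Lemma end_fixator0P (G : set (aut T)) (r : ray T) g :
  end_fixator0 G (\pi_(ends T) r) g <->
  G g /\ forall m, (dist (r 0%N) (g (r 0%N)) <= m.*2)%N -> g (r m) = r m.
Proof.
split=> [[Gg ge [z gz]]|[Gg gr]].
  by split=> //; apply: end_fixed_ray ge gz.
have gr' m : (dist (r 0%N) (g (r 0%N)) <= m)%N -> g (r m) = r m.
  by move=> le; apply: gr; lia.
split=> //; first by apply: ray_fixed_end gr'.
by exists (r (dist (r 0%N) (g (r 0%N)))); apply: gr'.
Qed.

Lemma closed_end_fixator0 (G : set (aut T)) (xi : ends T) :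
  closed G -> closed (end_fixator0 G xi).
Proof.
rewrite -[xi]reprK => cG f cl; apply/end_fixator0P; split.
  by apply: cG => B /cl[g [[Gg _ _] Bg]]; exists g.
move=> m; have [g] := closure_aut2 (repr xi 0%N) (repr xi m) cl.
by move=> /end_fixator0P[_ gr] [<- <-]; apply: gr.
Qed.

(** The vertices [y_ k] converge to the end of [r], in the form in which the
    convergence is used: the geodesics from the origin of [r] to [y_ k] follow
    [r] longer and longer. *)
Definition converges_along (r : ray T) (y_ : nat -> T) :=
  forall m, \forall k \near \oo, segment (r 0%N) (y_ k) (r m).

Lemma cvg_end_segment (y_ : nat -> T) (r : ray T) :
  (fun i => vertex_point (y_ i)) @ \oo --> end_point (\pi_(ends T) r) ->
  converges_along r y_.
Proof.
move=> cvg m; apply: (cvg (cone_nbhs r m)).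
apply: open_nbhs_nbhs; split; last by exists r.
suff : open (cone_nbhs r m) by [].
exists [set (cone_nbhs r m)]; last by rewrite bigcup_set1.
move=> _ ->; exists (finmap.fset1 (cone_nbhs r m : set (cone_space T))).
  2: by rewrite set_fset1 bigcap_set1.
by move=> A /finmap.fset1P ->; rewrite inE; right; exists r, m.
Qed.

(** Contracted elements fix [h_ k x] for [k] large, hence a subray of [r]. *)
Lemma contracted_sub (G : set (aut T)) (h_ : nat -> aut T) x r :
  converges_along r (fun k => h_ k x) ->
  contracted G h_ `<=` end_fixator0 G (\pi_(ends T) r).
Proof.
move=> cvg g [Gg /aut_cvgP/(_ x) gx]; apply/end_fixator0P; split=> // m le.
have {}gx : \forall k \near \oo, ((h_ k)^-1 * g * h_ k)%g x = x := gx.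
have [k [/= kx km]] := filter_ex (filterI gx (cvg m)).
apply: (@fix_on_segment _ g (r 0%N) _ (h_ k x)) => //.
  2: by rewrite dist_ray0.
by rewrite -{2}kx autVKV.
Qed.

(** Tits' independence property makes the contracted elements dense among the
    elliptic elements fixing the limit end. *)
Lemma end_fixator0_sub (G : set (aut T)) (h_ : nat -> aut T) x r :
  is_subgroup G -> tits_independence G ->
  converges_along r (fun k => h_ k x) ->
  end_fixator0 G (\pi_(ends T) r) `<=` closure (contracted G h_).
Proof.
move=> /subgroupP[G1 GV GM] tits cvg g /end_fixator0P[Gg gr].
apply: (@closure_autP _ _ (r 0%N)) => n.
pose j := (n + dist (r 0%N) (g (r 0%N)))%N.
have : fixator G [set r j; r j.+1] g.
  by split=> // z [->|->]; apply: gr; rewrite /j; lia.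
rewrite (tits _ _ (adj_ray r j)) => -[u [Gu ufix] [h [Gh hfix] uhg]].
have gE y : g y = u (h y) by rewrite -uhg.
exists h.
  (* [h] is contracted: it fixes [h_ k z], which is ahead for [k] large *)
  split=> //; apply/aut_cvgP => z.
  have := cvg (j.+1 + dist x z)%N; apply: filterS => k seg /=.
  rewrite hfix ?autVK //.
  by apply: (@half_tree_ahead _ _ _ (h_ k x)); rewrite dist_aut.
(* [u] is trivial behind the edge, which contains [y] and therefore [h y] *)
move=> y yn; rewrite gE.
have hj : h (r j) = r j by apply: hfix; left.
have hj1 : h (r j.+1) = r j.+1.
  by apply: hfix; right; rewrite /segment /= distxx addn0.
have : half_tree (r j.+1) (r j) y by apply: half_tree_behind; rewrite /j; lia.
case=> [->|seg]; first by rewrite hj1 ufix //; left.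
rewrite [RHS]ufix //; right; rewrite /segment /= in seg *.
have := dist_aut h (r j.+1) y; have := dist_aut h (r j) y.
by rewrite hj hj1 => -> ->.
Qed.
End AutTopology.

(** * Hilbert spaces and unitary representations *)

Section Hilbert.
Variables (R : realType) (H : hilbert R).
Local Open Scope ring_scope.
Implicit Types u w : H.

Lemma innerC u w : inner H w u = (inner H u w)^*.
Proof. by rewrite hermC expr0 mul1r. Qed.

Lemma cauchy_schwarz u w : `|inner H u w| <= `|u| * `|w|.
Proof.
have [->|w0] := eqVneq w 0; first by rewrite linear0r !normr0 mulr0.
have W0 : 0 < `|w| ^+ 2 by rewrite exprn_gt0 // normr_gt0.
(* expand the square norm of [u - a *: w], which is orthogonal to [w] *)
set d := inner H u w; pose a := d / `|w| ^+ 2.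
have : 0 <= inner H (u - a *: w) (u - a *: w) by rewrite inner_norm exprn_ge0.
have aW : a * `|w| ^+ 2 = d by rewrite divfK // gt_eqF.
have -> : inner H (u - a *: w) (u - a *: w) = `|u| ^+ 2 - `|d| ^+ 2 / `|w| ^+ 2.
  rewrite linearBl /= !linearBr /= !linearZr_LR /= !linearZl_LR /= !inner_norm.
  rewrite (innerC u w) -/d.
  have Wr : (`|w| ^+ 2)^* = `|w| ^+ 2 by rewrite conj_Creal // ger0_real // ltW.
  have aE : a^* = d^* / `|w| ^+ 2 by rewrite rmorphM fmorphV /= Wr.
  rewrite aE -[d *: (_ * d^*)]/(d * _) -[d *: (_ * _ ^+ 2)]/(d * _) normCK.
  by field; rewrite -sqrf_eq0 gt_eqF.
by rewrite subr_ge0 ler_pdivrMr // -exprMn ler_pXn2r // ?nnegrE ?mulr_ge0 //.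
Qed.

Lemma inner_eq u u' : (forall w, inner H u w = inner H u' w) -> u = u'.
Proof.
move=> e; apply/eqP; rewrite -subr_eq0 -normr_eq0 -sqrf_eq0 -inner_norm.
by rewrite linearBl /= e subrr.
Qed.
End Hilbert.

Lemma lim_eq_of_diff (K : numFieldType) (V : normedModType K) (a b : nat -> V)
    (l m : V) :
  a @ \oo --> l -> b @ \oo --> m ->
  (fun n => a n - b n)%R @ \oo --> (0%R : V) ->
  l = m.
Proof.
move=> al bm ab0.
have alm : (fun n => a n - b n)%R @ \oo --> (l - m)%R by apply: cvgB.
apply/eqP; rewrite -subr_eq0; apply/eqP.
exact: (cvg_unique (@norm_hausdorff _ V) alm ab0).
Qed.

Section Representation.
Variables (R : realType) (T : tree) (H : hilbert R) (G : set (aut T)).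
Variable pi : aut T -> H -> H.
Local Open Scope ring_scope.
Hypothesis Ggrp : is_subgroup G.
Hypothesis piG : unitary_representation G pi.

Lemma rep_inner g (u w : H) : G g -> inner H (pi g u) (pi g w) = inner H u w.
Proof. by move=> /(rep_unitary piG)[]. Qed.

Lemma rep_linear g : G g -> linear (pi g).
Proof. by move=> /(rep_unitary piG)[]. Qed.

Lemma repB g (u w : H) : G g -> pi g (u - w)%R = (pi g u - pi g w)%R.
Proof.
move=> /rep_linear lin; have := lin (-1)%R w u; rewrite !scaleN1r.
by rewrite !(addrC (- _)%R).
Qed.

Lemma rep1 u : pi 1%g u = u.
Proof.
have [G1 _ _] := subgroupP Ggrp; have [_ /bij_inj inj _] := rep_unitary piG G1.
by apply: inj; rewrite -(rep_mul piG) // mulg1.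
Qed.

Lemma repVK g u : G g -> pi g (pi g^-1%g u) = u.
Proof.
have [_ GV _] := subgroupP Ggrp => Gg.
by rewrite -(rep_mul piG) ?mulgV ?rep1 //; apply: GV.
Qed.

Lemma stabilizer_subgroup v : is_subgroup (stabilizer G pi v).
Proof.
have [G1 GV GM] := subgroupP Ggrp; split.
  by rewrite inE; split; rewrite ?rep1.
move=> g h; rewrite !inE => -[Gg gv] [Gh hv]; split.
  by apply: GM => //; apply: GV.
have hV : pi h^-1%g v = v.
  by rewrite -{1}hv -(rep_mul piG) ?mulVg ?rep1 //; apply: GV.
by rewrite (rep_mul piG) ?hV //; apply: GV.
Qed.

Lemma rep_nbhs g u (B : set H) : G g -> nbhs (pi g u) B ->
  nbhs g [set h | G h -> B (pi h u)].
Proof.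
move=> Gg; have := @rep_continuous _ _ _ _ _ piG u.
by move=> /subspace_continuousP/(_ g Gg); apply.
Qed.

(** Strong continuity on [G], along an arbitrary filter. *)
Lemma rep_cvg (S : Type) (F : set_system S) (c : S -> aut T) g u : Filter F ->
  G g -> (\forall s \near F, G (c s)) -> c @ F --> g ->
  (fun s => pi (c s) u) @ F --> pi g u.
Proof.
move=> FF Gg Gc cg B /(rep_nbhs Gg) nB.
by apply: (filterS _ (filterI Gc (cg _ nB))) => s [Gs]; apply.
Qed.

Lemma closed_stabilizer v : closed G -> closed (stabilizer G pi v).
Proof.
move=> cG f cl.
have Gf : G f by apply: cG => B /cl[g [[Gg _] Bg]]; exists g.
split=> //.
apply: contrapT => fv.
have nB : nbhs (pi f v) (~` [set v]).
  apply: open_nbhs_nbhs; split=> //; apply: closed_openC.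
  exact/accessible_closed_set1/hausdorff_accessible/norm_hausdorff.
by have [g [[Gg gv] /(_ Gg)]] := cl _ (rep_nbhs Gf nB); apply.
Qed.

(** Mautner phenomenon: with [c_n = h_n^-1 g h_n], the vector
    [pi (g h_n) v - pi (h_n) v] is the image of [pi (c_n) v - v] by [pi (h_n)],
    so it tends to 0 in norm, whereas it converges weakly to [pi g v0 - v0]. *)
Lemma mautner (h_ : nat -> aut T) v v0 : (forall n, G (h_ n)) ->
  weakly_converges (fun n => pi (h_ n) v) v0 ->
  contracted G h_ `<=` stabilizer G pi v0.
Proof.
have [G1 GV GM] := subgroupP Ggrp.
move=> Gh wc g [Gg cg]; split=> //; apply: inner_eq => w.
pose c n := ((h_ n)^-1 * g * h_ n)%g.
have Gc n : G (c n) by do 2?apply: (GM) => //; apply: GV.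
have cv : (fun n => pi (c n) v) @ \oo --> v.
  by rewrite -[X in _ --> X]rep1; apply: rep_cvg cg => //; apply: nearW.
have A := wc (pi g^-1%g w); have B := wc w.
have AB : (fun n => inner H (pi (h_ n) v) (pi g^-1%g w) : R[i]^o) @ \oo -->
    (inner H (pi g v0) w : R[i]^o).
  have <- : inner H v0 (pi g^-1%g w) = inner H (pi g v0) w; last exact: A.
  by rewrite -(rep_inner _ _ Gg) repVK.
have diff n : inner H (pi (h_ n) v) (pi g^-1%g w) - inner H (pi (h_ n) v) w =
    inner H (pi (h_ n) (pi (c n) v - v)) w.
  rewrite repB // linearBl /= -(rep_inner _ _ Gg) repVK //.
  congr (inner H _ w - _).
  by rewrite -!(rep_mul piG) // /c !mulgA mulgV mul1g.
apply: (lim_eq_of_diff AB B).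
apply/cvgr0Pnorm_lt => e e0.
have w1 : 0 < `|w| + 1 by rewrite ltr_wpDl.
have /cvgr_distC_lt/(_ _ (divr_gt0 e0 w1)) small := cv.
apply: filterS small => n small; rewrite diff.
apply: le_lt_trans (cauchy_schwarz _ _) _.
have -> : `|pi (h_ n) (pi (c n) v - v)| = `|pi (c n) v - v|.
  by apply/eqP; rewrite -(eqrXn2 (n := 2)) // -!inner_norm rep_inner.
move: small; rewrite ltr_pdivlMr //; apply: le_lt_trans.
by rewrite ler_wpM2l // lerDl.
Qed.
End Representation.

(** * End stabilizers and stabilizers of weak limits *)

(** The second inclusion, for an arbitrary sequence [h_] and a ray [r] towards
    the limit of [h_ n x]. *)
Lemma end_fixator0_stabilizer (R : realType) (T : tree) (G : set (aut T))
    (H : hilbert R) (pi : aut T -> H -> H) (h_ : nat -> aut T) (v v0 : H)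
    (x : T) (r : ray T) :
  is_subgroup G -> closed G -> tits_independence G ->
  unitary_representation G pi -> (forall n, G (h_ n)) ->
  weakly_converges (fun n => pi (h_ n) v) v0 ->
  converges_along r (fun n => h_ n x) ->
  end_fixator0 G (\pi_(ends T) r) `<=` stabilizer G pi v0.
Proof.
move=> Ggrp cG tits piG Gh wc cvg.
apply: subset_trans (end_fixator0_sub Ggrp tits cvg) _.
have /closure_id -> : closed (stabilizer G pi v0) by apply: closed_stabilizer.
exact: closureS (mautner Ggrp piG Gh wc).
Qed.

Lemma homo_cvg_infty (k_ : nat -> nat) :
  {homo k_ : i j / (i < j)%N} -> k_ @ \oo --> \oo.
Proof.
move=> kinc; have le n : (n <= k_ n)%N.
  by elim: n => // n IH; apply: leq_ltn_trans IH (kinc n n.+1 (ltnSn n)).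
move=> A [n _ nA]; exists n => // m /= nm.
by apply: nA => /=; apply: leq_trans nm (le m).
Qed.

Theorem proposition1p7 (R : realType) (T : tree) (G : set (aut T))
    (H : hilbert R) (pi : aut T -> H -> H) (g_ : nat -> aut T) (v v0 : H) :
  locally_finite T -> infinite_tree T ->
  is_subgroup G -> closed G -> ~ compact G -> tits_independence G ->
  unitary_representation G pi ->
  (forall n, G (g_ n)) -> tends_to_infinity G g_ ->
  weakly_converges (fun n => pi (g_ n) v) v0 -> v0 <> 0%R ->
  (forall xi : ends T,
     (forall (x : T) (k_ : nat -> nat),
        {homo k_ : i j / (i < j)%N} ->
        (fun i => vertex_point (g_ (k_ i) x)) @ \oo --> end_point xi ->
        contracted_closure G (fun i => g_ (k_ i)) `<=` end_fixator0 G xi /\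
        end_fixator0 G xi `<=` stabilizer G pi v0)) /\
  (~ compact (stabilizer G pi v0) ->
   (forall g, stabilizer G pi v0 g -> ~ hyperbolic g) ->
   exists eta : ends T, stabilizer G pi v0 = end_fixator0 G eta).
Proof.
move=> lf infT Ggrp cG _ tits piG Gg _ wc _; split.
  move=> xi x k_ kinc; rewrite -[xi]reprK => /cvg_end_segment cvg; split.
    have /closure_id -> : closed (end_fixator0 G (\pi_(ends T) (repr xi))).
      exact: closed_end_fixator0.
    exact: closureS (contracted_sub cvg).
  have wck : weakly_converges (fun i => pi (g_ (k_ i)) v) v0.
    by move=> w; apply: cvg_comp (homo_cvg_infty kinc) (wc w).
  exact: end_fixator0_stabilizer (fun i => Gg (k_ i)) wck cvg.
move=> ncS nohyp; set S := stabilizer G pi v0.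
have [x _] : exists x : T, [set: T] x.
  by apply: contrapT => nx; apply: infT; rewrite (_ : [set: T] = set0) //
    -subset0 => x _; apply: nx; exists x.
have Sgrp : is_subgroup S := stabilizer_subgroup Ggrp piG v0.
have unb n : exists2 g, S g & (n <= dist x (g x))%N.
  apply: contrapT => nbd; apply: ncS; apply: (@bounded_compact _ _ x n) => //.
    exact: closed_stabilizer.
  move=> g Sg; rewrite leqNgt; apply/negP => lt; apply: nbd.
  by exists g => //; apply: ltnW.
have [r [r0 rseg rfix]] := no_hyperbolic_fixes_ray Sgrp nohyp unb.
(* the end of [r] is the limit of [h_ n x] for elements [h_ n] of [S] of
   displacement at least [2 n] *)
exists (\pi_(ends T) r); apply/seteqP; split=> [g Sg|].
  by apply/end_fixator0P; split; [case: Sg|rewrite r0 => m; apply: rfix].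
have /choice[h_ h_P] : forall n, exists g, S g /\ (n.*2 <= dist x (g x))%N.
  by move=> n; have [g] := unb n.*2; exists g.
apply: (@end_fixator0_stabilizer _ _ _ _ _ h_ v0 v0 x) => //.
- by move=> n; have [[]] := h_P n.
- move=> w; rewrite (_ : (fun n => _) = (fun=> inner H v0 w)).
    exact: cvg_cst.
  by apply/funext => n; have [[_ ->]] := h_P n.
move=> m; exists m => // n /= mn; have [Sh le] := h_P n.
by rewrite r0; apply: rseg => //; apply: leq_trans le; rewrite leq_double.
Qed.
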